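(* Let $p>3$ be a prime. Then $$\sum_{k=0}^{(p-1)/2}\binom{2k}{k}\frac{T_{2k}(1,-3)}{4^k}\equiv\begin{cases}(-1)^{xy/2}\left(\frac{x}{3}\right)2x\pmod p&\text{if }p=x^2+3y^2\text{ with }x,y\in\mathbb{Z},\\ 0\pmod p&\text{if }p\equiv2\pmod 3.\end{cases}$$
   Context: For integers $b,c$ and $n\ge0$, $T_n(b,c)$ is the coefficient of $x^n$ in $(x^2+bx+c)^n$, i.e. $T_n(b,c)=\sum_{j=0}^{\lfloor n/2\rfloor}\binom{n}{2j}\binom{2j}{j}b^{n-2j}c^j$. The symbol $\left(\frac{\cdot}{3}\right)$ is the Legendre symbol modulo $3$. The congruence modulo $p$ is between rational numbers whose denominators are prime to $p$. *)

(* Defs.v *)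
From mathcomp Require Export all_boot all_order all_algebra.

Set Implicit Arguments.
Unset Strict Implicit.
Unset Printing Implicit Defensive.

Import Order.TTheory GRing.Theory Num.Theory.
Local Open Scope ring_scope.

(* Generalized central trinomial coefficient T_n(b, c). *)
Definition trinomial (n : nat) (b c : int) : int :=
  (('X^2 + b *: 'X + c%:P : {poly int}) ^+ n)`_n.

(* Legendre symbol (a / q); it has its usual meaning for q an odd prime. *)
Definition legendre (a : int) (q : nat) : int :=
  if (q%:Z %| a)%Z then 0
  else if [exists i : 'I_q, (i%:Z ^+ 2 == a %[mod q%:Z])%Z] then 1
  else -1.

(* a = b (mod p) in the ring of rationals whose denominators are prime to p.
   For p prime, since [numq] and [denq] are those of the reduced fraction, the
   last condition says that a - b is p times an element of that ring. *)
Definition ratcong (p : nat) (a b : rat) : Prop :=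
  [/\ coprimez (denq a) p%:Z, coprimez (denq b) p%:Z
    & (p%:Z %| numq (a - b))%Z].

(* Main.v *)
Require Import Defs.
From mathcomp Require Import all_boot all_order all_algebra.
From mathcomp Require Import cyclic finfield.
From mathcomp Require Import ring zify.

(** The sum is, modulo p, the trace of Frobenius of an elliptic curve with
    complex multiplication by Q(sqrt -3), and such a trace can be computed by
    elementary character sums.

    Write p = 2 h + 1, let chi be the quadratic character of F_p, and
    Q = X^2 + X - 3. Modulo p, 'C(2 k, k) / 4^k is (-1)^k 'C(h, k), and
    T_(2 k)(1, -3) is the central coefficient of Q^(2 k). By the binomial
    theorem the sum is the coefficient of degree 2 h = p - 1 of
    (X^2 - Q^2)^h = ((3 - X^2) (X^2 + 2 X - 3))^h. Summing a polynomial of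
    degree at most 2(p - 1) over F_p picks out, up to sign, its coefficients of
    degrees p - 1 and 2(p - 1), and an h-th power is a value of chi; so the sum
    is governed by the sum of chi over the values of a quartic
    ([coef_quartic_exp]). Moving the root 1 of the quartic to infinity and
    applying a 2-isogeny ([qchar_isogeny]) transforms the latter into
    A = sum_v chi (v^3 + 1), and the sum of the theorem is - chi(-2) A
    ([binomial_trinomial_sum]).

    If p = 2 modulo 3, cubing is a bijection and A = 0 ([cubic_sum_eq0]).

    If p = 1 modulo 3, consider B_a = chi(a) sum_v chi (v^3 + a). It depends
    only on the class of a modulo cubes. Orthogonality of the character gives
    the sum of B_a over the three classes, 0, and that of its square, 6 p.
    Together with congruences for A modulo 2 and 3 this implies A = 2 C with
    C^2 + 3 E^2 = p and C = -1 modulo 3 ([cubic_sum1_norm]). The representation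
    of a prime by x^2 + 3 y^2 is unique up to signs ([repr_unique]), hence C is
    x or - x, and C = - (x / 3) x by the congruence modulo 3. Finally chi(-2) is
    given by the supplements to quadratic reciprocity ([qchar_N2]) and equals
    (-1)^(x y / 2) ([sign_exponent]). *)

Set Implicit Arguments.
Unset Strict Implicit.
Unset Printing Implicit Defensive.

Import Order.TTheory GRing.Theory Num.Theory.
Local Open Scope ring_scope.

(** * The quadratic character of a finite field of odd order *)

(** Translation by 1 permutes the field, so it fixes the sum of all
    elements, while adding the number of elements to it. *)
Lemma natf_card (F : finFieldType) : #|F|%:R = 0 :> F.
Proof.
have: \sum_(x : F) (x + 1) = \sum_(x : F) x.
  by rewrite [RHS](reindex_inj (addIr 1)).
by rewrite big_split /= sumr_const -[RHS]addr0 => /addrI.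
Qed.

(** The values are integers, not field elements: the sums formed below are
    determined by identities in Z, and their residues would not suffice. *)
Definition qchar (F : finFieldType) (x : F) : int :=
  if x == 0 then 0 else if [exists y, y ^+ 2 == x] then 1 else -1.

Section OddFiniteField.

Variables (F : finFieldType) (h : nat).
Hypothesis cardF : #|F| = h.*2.+1.
Implicit Types a b d u v w x y z : F.

Lemma half_card_gt0 : (0 < h)%N.
Proof.
have := finNzRing_gt1 F; rewrite cardF; lia.
Qed.

Lemma natf_double : h.*2%:R = -1 :> F.
Proof.
have := natf_card F; rewrite cardF -natr1 => /eqP.
by rewrite addr_eq0 => /eqP.
Qed.

Lemma natf2_neq0 : 2 != 0 :> F.
Proof.
apply/eqP=> two0; have := natf_double.
rewrite -mul2n natrM two0 mul0r => /eqP.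
by rewrite eq_sym oppr_eq0 oner_eq0.
Qed.

Lemma one_neq_N1 : 1 != -1 :> F.
Proof. by rewrite -subr_eq0 opprK; exact: natf2_neq0. Qed.

Lemma expf_double x : x != 0 -> x ^+ h.*2 = 1.
Proof.
move=> x0; apply: (mulfI x0).
by rewrite -exprS -cardF expf_card mulr1.
Qed.

Lemma prim_root_exists : {z : F | h.*2.-primitive_root z}.
Proof.
pose rs := [seq x <- enum F | x != 0].
have : has h.*2.-primitive_root rs.
  apply: has_prim_root.
  - by rewrite double_gt0 half_card_gt0.
  - apply/allP=> x; rewrite mem_filter => /andP[x0 _].
    by apply/unity_rootP; exact: expf_double.
  - by rewrite filter_uniq ?enum_uniq.
  - have urs : uniq rs by rewrite filter_uniq ?enum_uniq.
    rewrite -(card_uniqP urs) -[h.*2]/(h.*2.+1.-1) -cardF -(cardC1 (0 : F)).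
    by apply/subset_leq_card/subsetP=> x; rewrite !inE mem_filter mem_enum andbT.
by move=> /hasP/sig2W[z _ zP]; exists z.
Qed.

Lemma gen_neq0 z : h.*2.-primitive_root z -> z != 0.
Proof.
by move=> zP; rewrite (prim_root_eq0 zP) double_eq0 -lt0n half_card_gt0.
Qed.

Lemma gen_expE z x : h.*2.-primitive_root z ->
  x != 0 -> exists i : 'I_h.*2, x = z ^+ i.
Proof. by move=> zP /expf_double/(prim_rootP zP)[i ->]; exists i. Qed.

Lemma sum_neq0_gen (V : nmodType) (f : F -> V) z : h.*2.-primitive_root z ->
  \sum_(x | x != 0) f x = \sum_(i < h.*2) f (z ^+ i).
Proof.
move=> zP.
transitivity (\sum_(x in [set z ^+ (i : 'I_h.*2) | i in 'I_h.*2]) f x).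
  apply: eq_bigl => x; apply/idP/imsetP => [/(gen_expE zP)[i ->]|[i _ ->]].
    by exists i.
  by rewrite expf_eq0 negb_and (gen_neq0 zP) orbT.
rewrite big_imset // => i j _ _ /eqP.
by rewrite (eq_prim_root_expr zP) !modn_small // => /eqP/val_inj.
Qed.

Lemma gen_exp_half z : h.*2.-primitive_root z -> z ^+ h = -1.
Proof.
move=> zP; have: (z ^+ h) ^+ 2 == 1.
  by rewrite -exprM muln2 (prim_expr_order zP).
rewrite sqrf_eq1 => /orP[|/eqP//].
rewrite -(prim_order_dvd zP) => /dvdn_leq -/(_ half_card_gt0).
by have := half_card_gt0; lia.
Qed.

(** Multiplication by a generator permutes the field and multiplies the sum
    by a factor different from 1 unless the order of the unit group divides
    the exponent. *)
Lemma sum_expr k :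
  \sum_(x : F) x ^+ k = - ((0 < k)%N && (h.*2 %| k)%N)%:R.
Proof.
have [z zP] := prim_root_exists.
case: k => [|k].
  under eq_bigr do rewrite expr0.
  by rewrite sumr_const natf_card oppr0.
have [/dvdnP[j kE] | ndiv] /= := boolP (h.*2 %| k.+1)%N; last first.
  have zk1: z ^+ k.+1 - 1 != 0 by rewrite subr_eq0 -(prim_order_dvd zP).
  have: \sum_(x : F) (z * x) ^+ k.+1 = \sum_(x : F) x ^+ k.+1.
    by rewrite [RHS](reindex_inj (mulfI (gen_neq0 zP))).
  rewrite (eq_bigr _ (fun x _ => exprMn k.+1 z x)) -mulr_sumr => /eqP.
  rewrite -subr_eq0 -{2}[\sum_x _]mul1r -mulrBl.
  by rewrite mulf_eq0 (negPf zk1) oppr0 => /eqP.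
have pow1 x : x != 0 -> x ^+ k.+1 = 1.
  by move=> x0; rewrite kE mulnC exprM expf_double ?expr1n.
rewrite (bigD1 0) //= (eq_bigr _ pow1) expr0n add0r sumr_const.
by rewrite cardC1 cardF natf_double.
Qed.

(** This turns a coefficient of a polynomial of degree at most 2(q - 1) into
    its values, hence, for an h-th power, into a quadratic character sum. *)
Lemma sum_horner (P : {poly F}) : (size P <= (h.*2.*2).+1)%N ->
  \sum_(x : F) P.[x] = - (P`_(h.*2) + P`_(h.*2.*2)).
Proof.
move=> szP; have h0 := half_card_gt0.
under eq_bigr do rewrite (horner_coef_wide _ szP).
rewrite exchange_big /=.
have mulE (k : nat) : (0 < k < (h.*2.*2).+1)%N && (h.*2 %| k)%N =
    (k == h.*2) || (k == h.*2.*2).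
  apply/andP/orP => [[lek /dvdnP[j kE]]|[]/eqP->].
  - have : (j = 1 \/ j = 2)%N by nia.
    by case=> jE; [left|right]; apply/eqP; rewrite kE jE; lia.
  - by rewrite dvdnn; split=> //; lia.
  - by rewrite -[X in (_ %| X)%N]mul2n dvdn_mull //; split=> //; lia.
have ltk : (h.*2 < (h.*2.*2).+1)%N by lia.
rewrite (bigD1 (Ordinal ltk)) //= (bigD1 ord_max) /=; last first.
  by rewrite -val_eqE /=; lia.
rewrite [X in _ + (_ + X)]big1 ?addr0 => [|i /andP[i1 i2]].
  rewrite -!mulr_sumr !sum_expr dvdnn double_gt0 h0 -[X in (_ %| X)%N]mul2n.
  by rewrite dvdn_mull // ?double_gt0 h0 /= !mulrN1 opprD.
rewrite -mulr_sumr sum_expr.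
have := mulE i; rewrite ltn_ord andbT => ->.
move: i1 i2; rewrite -!val_eqE /= => /negPf-> /negPf->.
by rewrite oppr0 mulr0.
Qed.

(** Euler's criterion: a non-square is an odd power of a generator, and the
    h-th power of a generator is -1. *)
Lemma qcharE x : (qchar x)%:~R = x ^+ h.
Proof.
rewrite /qchar; have [->|x0] := eqVneq x 0.
  by rewrite expr0n eqn0Ngt half_card_gt0.
case: existsP => [[y /eqP yx]|nsq].
  rewrite -yx -exprM mul2n expf_double //.
  by move: x0; rewrite -yx expf_eq0.
have [z zP] := prim_root_exists.
have [i xE] := gen_expE zP x0.
have odi : odd i.
  apply/negPn/negP => /even_halfK ei; apply: nsq; exists (z ^+ i./2).
  by rewrite -exprM muln2 ei xE.
rewrite xE -exprM mulnC exprM (gen_exp_half zP) -signr_odd odi expr1.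
by rewrite mulrN1z.
Qed.

Lemma qchar0 : qchar (0 : F) = 0.
Proof. by rewrite /qchar eqxx. Qed.

Lemma qchar_cases x : [\/ qchar x = 0, qchar x = 1 | qchar x = -1].
Proof.
rewrite /qchar; case: eqP => _; first exact: Or31.
by case: ifP => _; [exact: Or32|exact: Or33].
Qed.

Lemma qchar_le1 x : `|qchar x| <= 1.
Proof. by case: (qchar_cases x) => ->. Qed.

(** Identities between values of the quadratic character, which are
    integers, can thus be checked on the h-th powers of Euler's criterion. *)
Lemma sign_intr_inj (m n : int) : `|m| <= 1 -> `|n| <= 1 ->
  m%:~R = n%:~R :> F -> m = n.
Proof.
have cases (k : int) : `|k| <= 1 -> [\/ k = 0, k = 1 | k = -1].
  move=> k1; have [? | [? | ?]] : k = 0 \/ k = 1 \/ k = -1 by lia.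
  - exact: Or31.
  - exact: Or32.
  - exact: Or33.
have o := oner_neq0 F; have t := one_neq_N1.
move=> /cases[]-> /cases[]-> //; rewrite ?mulrN1z ?mulr1z ?mulr0z => /eqP.
- by rewrite eq_sym (negPf o).
- by rewrite eq_sym oppr_eq0 (negPf o).
- by rewrite (negPf o).
- by rewrite (negPf t).
- by rewrite oppr_eq0 (negPf o).
- by rewrite eq_sym (negPf t).
Qed.

Lemma qcharM x y : qchar (x * y) = qchar x * qchar y.
Proof.
apply: sign_intr_inj; rewrite ?qchar_le1 //.
  by rewrite normrM mulr_ile1 ?normr_ge0 ?qchar_le1.
by rewrite intrM !qcharE exprMn.
Qed.

Lemma qchar1 : qchar (1 : F) = 1.
Proof.
rewrite /qchar oner_eq0; case: existsP => // -[].
by exists 1; rewrite expr1n.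
Qed.

Lemma qcharX x n : (0 < n)%N -> qchar (x ^+ n) = qchar x ^+ n.
Proof.
by case: n => // n _; elim: n => [|n IH]; rewrite ?expr1 // exprS qcharM IH.
Qed.

Lemma qchar_sqr x : qchar x ^+ 2 = (x != 0)%:R.
Proof.
have [->|x0] := eqVneq x 0; first by rewrite qchar0.
rewrite /qchar (negPf x0); by case: ifP.
Qed.

Lemma qchar_sqrM x y : x != 0 -> qchar (x ^+ 2 * y) = qchar y.
Proof. by move=> x0; rewrite qcharM qcharX // qchar_sqr x0 mul1r. Qed.

Lemma qchar_gen z : h.*2.-primitive_root z -> qchar z = -1.
Proof.
move=> zP; apply: sign_intr_inj; rewrite ?qchar_le1 //.
by rewrite qcharE (gen_exp_half zP) mulrN1z.
Qed.

Lemma sum_qchar : \sum_(x : F) qchar x = 0.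
Proof.
have [z zP] := prim_root_exists.
have: \sum_(x : F) qchar (z * x) = \sum_(x : F) qchar x.
  by rewrite [RHS](reindex_inj (mulfI (gen_neq0 zP))).
rewrite (eq_bigr _ (fun x _ => qcharM z x)) -mulr_sumr (qchar_gen zP).
set S := \sum_x _; lia.
Qed.

Lemma card_sqrt w : #|[set y | y ^+ 2 == w]|%:Z = 1 + qchar w.
Proof.
have [->|w0] := eqVneq w 0.
  rewrite qchar0 (_ : [set _ | _] = [set 0]) ?cards1 //.
  by apply/setP=> y; rewrite !inE expf_eq0.
rewrite /qchar (negPf w0); case: existsP => [[y /eqP yw]|nsq]; last first.
  rewrite (_ : [set _ | _] = set0) ?cards0 //.
  by apply/setP=> y; rewrite !inE; apply/negP => yw; apply: nsq; exists y.
rewrite (_ : [set _ | _] = [set y; - y]); last first.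
  by apply/setP=> u; rewrite !inE -yw eqf_sqr.
have y0 : y != 0 by move: w0; rewrite -yw expf_eq0.
rewrite cards2 -addr_eq0 -[y in y + _]mulr1 -[y in _ + y]mulr1 -mulrDr mulf_eq0.
by rewrite (negPf y0) (negPf natf2_neq0).
Qed.

(** After translation the summand is the character of a (d + a) with
    d = v - u, which for d != 0 and a != 0 is that of 1 + d / a; and
    1 + d / a takes every value other than 1 exactly once. *)
Lemma sum_qchar_shift u v :
  \sum_a qchar ((u + a) * (v + a)) = (u == v)%:Z * #|F|%:Z - 1.
Proof.
rewrite (reindex_inj (addrI (- u))) /=.
under eq_bigr do rewrite addNKr addrA.
rewrite (bigD1 0) //= mul0r qchar0 add0r.
have [->|uv] := eqVneq u v.
  rewrite (eq_bigr (fun=> 1)) => [|a a0]; last first.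
    by rewrite subrr add0r -expr2 qcharX // qchar_sqr a0.
  rewrite sumr_const cardC1 cardF; lia.
have d0 : v - u != 0 by rewrite subr_eq0 eq_sym.
set d := v - u in d0 *.
rewrite (eq_bigr (fun a => qchar (1 + d / a))) => [|a a0]; last first.
  by rewrite -(qchar_sqrM (1 + d / a) a0); congr qchar; field.
transitivity (\sum_(b : F | b != 1) qchar b).
  rewrite [RHS](reindex_onto (fun a => 1 + d / a) (fun b => d / (b - 1))) /=.
    apply: eq_bigl => a; have e : 1 + d / a - 1 = d / a by ring.
    rewrite -[1 + d / a == 1]subr_eq0 e.
    rewrite mulf_eq0 (negPf d0) /= invr_eq0.
    have [->|a0] /= := eqVneq a 0; first by [].
    by rewrite invf_div mulrCA divff // mulr1 eqxx.
  move=> b; rewrite -subr_eq0 => b1; by field; rewrite d0 b1.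
have := sum_qchar; rewrite (bigD1 1) //= qchar1 mul0r.
by set S := \sum_(_ | _) _; lia.
Qed.

(** This is the equality of the numbers of points of two elliptic curves
    linked by a 2-isogeny. Since x (x^2 + a x + b) = x^2 (x + b / x + a), the
    left side is a sum over w = x + b / x, and w is attained as many times as
    w^2 - 4 b has square roots, that is 1 + qchar (w^2 - 4 b) times. *)
Lemma qchar_isogeny a b : b != 0 ->
  \sum_x qchar (x * (x ^+ 2 + a * x + b)) =
  \sum_x qchar (x * (x ^+ 2 - 2 * a * x + (a ^+ 2 - 4 * b))).
Proof.
move=> b0; rewrite (bigD1 0) //= mul0r qchar0 add0r.
rewrite (eq_bigr (fun x => qchar (x + b / x + a))) => [|x x0]; last first.
  by rewrite -[RHS](qchar_sqrM _ x0); congr qchar; field.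
rewrite (partition_big (fun x => x + b / x) xpredT) //=.
transitivity (\sum_(w : F) (1 + qchar (w ^+ 2 - 4 * b)) * qchar (w + a)).
  apply: eq_bigr => w _; rewrite -card_sqrt.
  rewrite (eq_bigr (fun=> qchar (w + a))) => [|x /andP[_ /eqP->] //].
  rewrite sumr_const -[LHS]mulr_natl natz; congr (Posz _ * _).
  (* completing the square in x ^+ 2 - w * x + b *)
  have bij2 : bijective (fun x => 2 * x - w).
    by exists (fun y => (y + w) / 2) => x; field; exact: natf2_neq0.
  rewrite -[RHS](on_card_preimset (onW_bij _ bij2)).
  rewrite -cardsE; apply: eq_card => x; rewrite !inE unfold_in.
  have -> : ((2 * x - w) ^+ 2 == w ^+ 2 - 4 * b) = (x ^+ 2 - w * x + b == 0).
    rewrite -subr_eq0 (_ : _ - _ = 2 ^+ 2 * (x ^+ 2 - w * x + b)); last by ring.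
    by rewrite mulf_eq0 expf_eq0 /= (negPf natf2_neq0).
  have [->|x0] /= := eqVneq x 0.
    by rewrite mulr0 expr0n subr0 add0r (negPf b0).
  rewrite -subr_eq0 (_ : _ - w = (x ^+ 2 - w * x + b) / x); last by field.
  by rewrite mulf_eq0 invr_eq0 (negPf x0) orbF.
under [LHS]eq_bigr do rewrite mulrDl mul1r.
rewrite big_split /=.
have -> : \sum_(w : F) qchar (w + a) = 0.
  by rewrite -[RHS]sum_qchar [RHS](reindex_inj (addIr a)).
rewrite add0r [RHS](reindex_inj (addIr a)).
by apply: eq_bigr => w _; rewrite -qcharM; congr qchar; ring.
Qed.

End OddFiniteField.

(** * Reduction of the quartic character sum to cubic ones *)

Definition cubic_sum (F : finFieldType) (a : F) : int :=
  \sum_v qchar (v ^+ 3 + a).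

Section CubicSums.

Variables (F : finFieldType) (h : nat).
Hypothesis cardF : #|F| = h.*2.+1.
Implicit Types a b t u v x y : F.

Lemma cubic_sum_scale a t : t != 0 ->
  cubic_sum (t ^+ 3 * a) = qchar t * cubic_sum a.
Proof.
move=> t0; rewrite /cubic_sum (reindex_inj (mulfI t0)) mulr_sumr.
apply: eq_bigr => v _.
rewrite -(qcharM cardF) -(qchar_sqrM cardF (t * _) t0); congr qchar; ring.
Qed.

(** If q = 2 modulo 3 then cubing permutes the field, and the sum is that of
    the character over the whole field. *)
Lemma cubic_sum_eq0 k a : #|F| = (3 * k + 2)%N -> cubic_sum a = 0.
Proof.
move=> cardF2; have inj3 : injective (fun v => v ^+ 3).
  (* 3 (2 k + 1) = 1 modulo q - 1 *)
  apply: (can_inj (g := fun v => v ^+ (2 * k + 1))) => v.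
  rewrite -exprM (_ : (_ * _ = #|F| + h.*2)%N); last by lia.
  rewrite exprD expf_card; have [->|v0] := eqVneq v 0; first by rewrite mul0r.
  by rewrite (expf_double cardF) ?mulr1.
rewrite -(sum_qchar cardF) [RHS](reindex_inj (addIr a)).
by rewrite [RHS](reindex_inj inj3).
Qed.

(** The quartic has the rational root x = 1. Sending it to infinity gives a
    cubic with a rational root, whose 2-isogenous curve is, up to
    translation, y^2 = u^3 - 64, a twist of y^2 = v^3 + 1. *)
Lemma quartic_sum : 3 != 0 :> F ->
  \sum_(x : F) qchar ((3 - x ^+ 2) * (x ^+ 2 + 2 * x - 3)) =
  qchar (-2 : F) * cubic_sum (1 : F) - qchar (-1 : F).
Proof.
move=> three0; have two0 := natf2_neq0 cardF.
have four0 : 4 != 0 :> F by rewrite (natrM _ 2 2) mulf_neq0.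
have qM := qcharM cardF.
(* x = 1 + 1 / t; the value at t = 0, which corresponds to no x, is corrected *)
transitivity (\sum_(t : F) qchar ((2 * t ^+ 2 - 2 * t - 1) * (4 * t + 1))
              - qchar (-1 : F)).
  rewrite (bigD1 1) //= (_ : _ + 2 * 1 - 3 = 0); last by ring.
  rewrite mulr0 qchar0 add0r [in RHS](bigD1 0) //=.
  rewrite (_ : (_ - 2 * 0 - 1) * _ = -1); last by ring.
  rewrite addrAC subrr add0r.
  rewrite (reindex_onto (fun t : F => 1 + t^-1) (fun x => (x - 1)^-1)) /=.
    apply: eq_big => t.
      rewrite addrAC subrr add0r invrK eqxx andbT.
      by rewrite -subr_eq0 addrAC subrr add0r invr_eq0.
    rewrite addrAC subrr add0r invrK eqxx andbT => t1.
    have t0 : t != 0.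
      by apply: contra t1 => /eqP->; rewrite invr0 addr0.
    rewrite -(qchar_sqrM cardF _ (expf_neq0 2 t0)); congr qchar; field => //.
  by move=> x _; rewrite invrK addrCA subrr addr0.
congr (_ - _).
(* s = 4 * t + 1 *)
transitivity (qchar (2 : F) *
    \sum_(s : F) qchar (s * (s ^+ 2 + (-6) * s + (-3)))).
  rewrite mulr_sumr.
  have bij : bijective (fun t : F => 4 * t + 1).
    by exists (fun s : F => (s - 1) / 4) => t; field.
  rewrite [RHS](reindex_inj (bij_inj bij)) /=; apply: eq_bigr => t _.
  rewrite -qM -(qchar_sqrM cardF (_ * _) four0); congr qchar; ring.
rewrite (qchar_isogeny cardF) ?oppr_eq0 //.
have -> : -2 = 2 * (-1) :> F by ring.
rewrite qM -mulrA; congr (_ * _).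
(* (u - 4) ((u - 4)^2 + 12 (u - 4) + 48) = u^3 - 64, and then u = -4 v *)
rewrite mulr_sumr (reindex_inj (addIr (-4))) /=.
have m4 : -4 != 0 :> F by rewrite oppr_eq0.
rewrite (reindex_inj (mulfI m4)) /=; apply: eq_bigr => v _.
have eight0 : 2 ^+ 3 != 0 :> F by rewrite expf_neq0.
rewrite -qM -(qchar_sqrM cardF (-1 * _) eight0); congr qchar; ring.
Qed.

End CubicSums.

(** * The cubic sum when the order of the field is 1 modulo 6 *)

Section CubicClasses.

Variables (F : finFieldType) (m : nat).
Hypothesis cardF : #|F| = (3 * m).*2.+1.
Implicit Types a b t u v x y : F.

Variable z : F.
Hypothesis zP : (3 * m).*2.-primitive_root z.

Local Notation z0 := (gen_neq0 cardF zP).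

Lemma sixth_card_gt0 : (0 < m)%N.
Proof. by have := half_card_gt0 cardF; lia. Qed.

(** The cube roots of unity are 1, w and w^2 for w = z^(2 m). *)
Lemma card_cube_fiber v : v != 0 -> #|[set u | u ^+ 3 == v ^+ 3]| = 3%N.
Proof.
move=> v0; pose w := z ^+ (2 * m).
have w3 : w ^+ 3 = 1.
  by rewrite -exprM -(prim_expr_order zP); congr (_ ^+ _); lia.
have w1 : w - 1 != 0.
  rewrite subr_eq0 -(prim_order_dvd zP); apply/negP => /dvdn_leq.
  by have := sixth_card_gt0; lia.
have wE : w ^+ 2 = - w - 1.
  apply/eqP; rewrite -subr_eq0; apply/eqP/(mulfI w1).
  by rewrite mulr0 -[RHS](subrr (w ^+ 3)) {2}w3; ring.
have w0 : w != 0 by rewrite expf_neq0 ?z0.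
rewrite (_ : [set _ | _] = [set v; w * v; w ^+ 2 * v]); last first.
  apply/setP=> u; rewrite !inE -subr_eq0.
  have -> : u ^+ 3 - v ^+ 3 = (u - v) * (u - w * v) * (u - w ^+ 2 * v).
    rewrite (_ : (u - v) * _ * _ = u ^+ 3 - (1 + w + w ^+ 2) * u ^+ 2 * v
      + (1 + w + w ^+ 2) * w * u * v ^+ 2 - w ^+ 3 * v ^+ 3); last by ring.
    by rewrite wE w3; ring.
  by rewrite !mulf_eq0 !subr_eq0.
rewrite -setUA cardsU1 cards2 !inE.
have neq (c d : F) : c - d != 0 -> c * v != d * v.
  by move=> cd; rewrite -subr_eq0 -mulrBl mulf_neq0.
have n1 : v != w * v by rewrite -{1}[v]mul1r neq // -opprB oppr_eq0.
have n2 : w * v != w ^+ 2 * v.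
  by rewrite neq // (_ : w - _ = - (w * (w - 1))) ?oppr_eq0 ?mulf_neq0 //; ring.
have n3 : v != w ^+ 2 * v.
  rewrite -{1}[v]mul1r neq // -w3 (_ : _ - _ = w ^+ 2 * (w - 1)); last by ring.
  by rewrite mulf_neq0 // expf_neq0.
by rewrite (negPf n1) (negPf n2) (negPf n3).
Qed.

(** Expanding the square and summing over a first leaves, up to a constant,
    q times the number of pairs (u, v) with u^3 = v^3, which is 3 q - 2. *)
Lemma sum_cubic_sum_sqr :
  \sum_(a : F) cubic_sum a ^+ 2 = 2 * #|F|%:Z * (#|F|%:Z - 1).
Proof.
set q := #|F|%:Z.
transitivity (\sum_(u : F) \sum_(v : F) ((v ^+ 3 == u ^+ 3)%:Z * q - 1)).
  under eq_bigr do rewrite expr2 /cubic_sum big_distrlr /=.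
  rewrite exchange_big /=; apply: eq_bigr => u _.
  rewrite exchange_big /=; apply: eq_bigr => v _.
  rewrite [_ == _]eq_sym -(sum_qchar_shift cardF).
  by apply: eq_bigr => a _; rewrite (qcharM cardF).
have inner u : \sum_(v : F) ((v ^+ 3 == u ^+ 3)%:Z * q - 1) =
    #|[set v | v ^+ 3 == u ^+ 3]|%:Z * q - q.
  rewrite sumrB sumr_const natz -mulr_suml; congr (_ * _ - _).
  rewrite -sum1_card -natz natr_sum [RHS]big_mkcond /=.
  by apply: eq_bigr => v _; rewrite inE; case: (_ == _).
under eq_bigr do rewrite inner.
rewrite (bigD1 0) //= (_ : [set _ | _] = [set 0]); last first.
  by apply/setP=> v; rewrite !inE expr0n /= expf_eq0.
rewrite cards1 (eq_bigr (fun=> 3 * q - q)) => [|u u0]; last first.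
  by rewrite card_cube_fiber.
rewrite sumr_const cardC1 -[_ *+ _]mulr_natl natz.
by rewrite (_ : #|F|.-1%:Z = q - 1); [ring|rewrite /q cardF; lia].
Qed.

(** The twist removes the sign in the dependence of cubic_sum on a cube
    factor of a, so that only the class of a modulo cubes matters. *)
Definition twisted_sum a : int := qchar a * cubic_sum a.

Lemma twisted_sum0 : twisted_sum 0 = 0.
Proof. by rewrite /twisted_sum qchar0 mul0r. Qed.

Lemma twisted_sum_scale a t : t != 0 ->
  twisted_sum (t ^+ 3 * a) = twisted_sum a.
Proof.
move=> t0; rewrite /twisted_sum (cubic_sum_scale cardF) // (qcharM cardF).
rewrite (qcharX cardF) // mulrACA -exprSr.
by rewrite (exprM _ 2 2) (qchar_sqr) t0 expr1n mul1r.
Qed.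

(** The inner sum over a is that of the character of a (v^3 + a), which is
    -1 except for v = 0. *)
Lemma sum_twisted_sum : \sum_(a : F) twisted_sum a = 0.
Proof.
rewrite /twisted_sum /cubic_sum.
under eq_bigr do rewrite mulr_sumr.
rewrite exchange_big /=.
rewrite (eq_bigr (fun v : F => (v == 0)%:Z * #|F|%:Z - 1)) => [|v _]; last first.
  have <- : (0 == v ^+ 3) = (v == 0) by rewrite eq_sym expf_eq0.
  rewrite -(sum_qchar_shift cardF).
  by apply: eq_bigr => a _; rewrite add0r (qcharM cardF).
rewrite sumrB sumr_const natz (bigD1 0) //= eqxx mul1r big1 ?addr0 ?subrr //.
by move=> v /negPf->; rewrite mul0r.
Qed.

Lemma sum_periodic (f : nat -> int) n : (forall i, f (i + n)%N = f i) ->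
  \sum_(i < 3 * n) f i = 3 * \sum_(i < n) f i.
Proof.
move=> fE; rewrite !mulSn mul0n addn0 !big_split_ord /=.
under [X in _ + (X + _)]eq_bigr do rewrite addnC fE.
under [X in _ + (_ + X)]eq_bigr do rewrite addnC fE addnC fE.
ring.
Qed.

(** 1, z and z^2 represent the three classes of units modulo cubes. *)
Lemma sum_cubic_classes (f : F -> int) :
  (forall a t, t != 0 -> f (t ^+ 3 * a) = f a) ->
  \sum_(a | a != 0) f a = (2 * m)%N%:Z * (f 1 + f z + f (z ^+ 2)).
Proof.
move=> fE; rewrite (sum_neq0_gen cardF _ zP).
have -> : (3 * m).*2 = (2 * m * 3)%N by lia.
elim: (2 * m)%N => [|n IH]; first by rewrite big_ord0 mul0r.
rewrite mulSn addnC big_split_ord /= IH.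
have fz j : f (z ^+ (n * 3 + j)%N) = f (z ^+ j).
  by rewrite exprD exprM fE // expf_neq0 ?z0.
rewrite !big_ord_recr big_ord0 /= !fz expr0 expr1.
by rewrite -[n.+1]addn1 PoszD; ring.
Qed.

(** For v != 0 the summand depends on v^3 only, so each value occurs for
    three values of v; v = 0 contributes 1. *)
Lemma cubic_sum1_mod3 : exists k, cubic_sum (1 : F) = 3 * k + 1.
Proof.
exists (\sum_(i < 2 * m) qchar (z ^+ i ^+ 3 + 1)).
rewrite /cubic_sum (bigD1 0) //= expr0n add0r (qchar1) addrC.
congr (_ + _); rewrite (sum_neq0_gen cardF _ zP).
have -> : (3 * m).*2 = (3 * (2 * m))%N by lia.
rewrite (sum_periodic (f := fun i => qchar (z ^+ i ^+ 3 + 1))) // => i.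
congr (qchar (_ + 1)); rewrite -!exprM mulnDl exprD.
rewrite (_ : (2 * m * 3 = (3 * m).*2)%N); last by lia.
by rewrite (prim_expr_order zP) mulr1.
Qed.

(** All the terms are odd except the three where v^3 = -1, and q - 3 is
    even. *)
Lemma cubic_sum1_even : exists k, cubic_sum (1 : F) = 2 * k.
Proof.
have qE x : qchar x = 1 - (x == 0)%:Z - 2 * (qchar x == -1)%:Z.
  by rewrite /qchar; case: (x == 0) => //; case: [exists _, _].
rewrite /cubic_sum (eq_bigr _ (fun v _ => qE (v ^+ 3 + 1))) !sumrB.
rewrite -mulr_sumr sumr_const natz.
have -> : \sum_(v : F) (v ^+ 3 + 1 == 0)%:Z = 3.
  have n1 : -1 != 0 :> F by rewrite oppr_eq0 oner_eq0.
  have <- : #|[set u : F | u ^+ 3 == (-1) ^+ 3]|%:Z = 3.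
    by rewrite card_cube_fiber.
  rewrite -sum1_card -[RHS]natz natr_sum [RHS]big_mkcond /=.
  apply: eq_bigr => v _; rewrite inE addr_eq0.
  rewrite (_ : (-1) ^+ 3 = -1); last by ring.
  by case: (_ == _).
set S := \sum_v _; exists ((3 * m)%N%:Z - 1 - S).
by rewrite cardF -natz; lia.
Qed.

(** The numbers other than 2 C are - C + D and - C - D with D = b + C, whence
    3 C^2 + D^2 = 3 q, and D is a multiple of 3. *)
Lemma norm_of_three (C b c q : int) :
  2 * C + b + c = 0 -> (2 * C) ^+ 2 + b ^+ 2 + c ^+ 2 = 6 * q ->
  exists E, C ^+ 2 + 3 * E ^+ 2 = q.
Proof.
move=> lin quad; have bE : b = (b + C) - C by rewrite addrK.
have cE : c = - (b + C) - C.
  by apply/eqP; rewrite -subr_eq0 -[X in _ == X]lin; apply/eqP; ring.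
have DE : (b + C) ^+ 2 = 3 * (q - C ^+ 2).
  apply: (mulfI (isT : 2 != 0 :> int)).
  transitivity (6 * q - 6 * C ^+ 2); last by ring.
  by rewrite -quad cE; ring.
have : (3 %| b + C)%Z.
  have : (3 %| (b + C) ^+ 2)%Z by rewrite DE dvdz_mulr.
  by rewrite !dvdzE abszX Euclid_dvdX // => /andP[].
case/dvdzP=> E EE; exists E; apply: (mulfI (isT : 3 != 0 :> int)).
transitivity (3 * C ^+ 2 + (E * 3) ^+ 2); first by ring.
by rewrite -EE DE; ring.
Qed.

(** The twisted sums over the three cubic classes add up to 0 and their
    squares to 6 q. *)
Lemma cubic_sum1_norm : exists C E : int,
  [/\ cubic_sum (1 : F) = 2 * C, C ^+ 2 + 3 * E ^+ 2 = #|F|%:Z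
    & exists k, C = 3 * k - 1].
Proof.
have [C CE] := cubic_sum1_even; have [k kE] := cubic_sum1_mod3.
pose B i := twisted_sum (z ^+ i).
have B0 : twisted_sum 1 = 2 * C.
  by rewrite /twisted_sum (qchar1) mul1r CE.
have m0 := sixth_card_gt0.
have lin : 2 * C + B 1%N + B 2%N = 0.
  have := sum_twisted_sum; rewrite (bigD1 0) //= twisted_sum0 add0r.
  rewrite sum_cubic_classes; last exact: twisted_sum_scale.
  rewrite B0 => /eqP; rewrite mulf_eq0 => /orP[|/eqP//]; lia.
have quad : (2 * C) ^+ 2 + B 1%N ^+ 2 + B 2%N ^+ 2 = 6 * #|F|%:Z.
  have : \sum_(a : F) twisted_sum a ^+ 2 = 2 * #|F|%:Z * (#|F|%:Z - 1).
    rewrite -sum_cubic_sum_sqr; apply: eq_bigr => a _.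
    rewrite exprMn (qchar_sqr); have [->|a0] := eqVneq a 0; last first.
      by rewrite mul1r.
    rewrite mul0r (_ : cubic_sum _ = 0) // -[RHS](sum_qchar cardF).
    apply: eq_bigr => v _; rewrite addr0.
    have [->|v0] := eqVneq v 0; first by rewrite expr0n.
    by rewrite exprSr (qchar_sqrM cardF).
  rewrite (bigD1 0) //= twisted_sum0 expr0n add0r.
  rewrite (@sum_cubic_classes (fun a => twisted_sum a ^+ 2)); last first.
    by move=> a t t0; rewrite twisted_sum_scale.
  rewrite B0 -/(B 1%N) -/(B 2%N) => e.
  have : (2 * m)%N%:Z != 0 by lia.
  move=> /mulfI; apply; rewrite e cardF; lia.
have [E EE] := norm_of_three lin quad.
exists C, E; split=> //; exists (C - k).
by move: CE kE => ->; clear; lia.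
Qed.

End CubicClasses.

(** * The binomial sum as a polynomial coefficient *)

Lemma bin_double_rec k :
  (k.+1 * 'C(2 * k.+1, k.+1) = 2 * (2 * k).+1 * 'C(2 * k, k))%N.
Proof.
have sym : 'C((2 * k).+1, k) = 'C((2 * k).+1, k.+1).
  by rewrite -bin_sub; [congr ('C(_, _))|]; lia.
have /= d1 := mul_bin_diag (2 * k).+2 k.
have /= d2 := mul_bin_diag (2 * k).+1 k.
have -> : (2 * k.+1 = (2 * k).+2)%N by lia.
rewrite -d1 sym -mulnA d2; lia.
Qed.

(** The binomial theorem: the exponents are such that the factor 'X^2 ^+ (h - k)
    shifts the coefficient of degree 2 h to the central one of Q ^+ (2 k). *)
Lemma coef_exp_diff_sqr (R : comNzRingType) (Q : {poly R}) h :
  (('X^2 - Q ^+ 2) ^+ h)`_(2 * h) =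
  \sum_(k < h.+1) (-1) ^+ k * 'C(h, k)%:R * (Q ^+ (2 * k))`_(2 * k).
Proof.
rewrite exprDn coef_sum; apply: eq_bigr => k _.
rewrite coefMn [(- Q ^+ 2) ^+ k]exprNn -!exprM coefXnM.
have lek : (k <= h)%N by rewrite -ltnS.
rewrite ltnNge (_ : (2 * (h - k) <= 2 * h)%N) /=; last by lia.
rewrite (_ : (2 * h - 2 * (h - k) = 2 * k)%N); last by lia.
rewrite -polyC1 -polyCN -polyC_exp coefCM -mulr_natr; ring.
Qed.

Lemma intr_trinomial (R : comNzRingType) n (b c : int) :
  (trinomial n b c)%:~R =
  (('X^2 + b%:~R *: 'X + (c%:~R)%:P : {poly R}) ^+ n)`_n.
Proof.
rewrite /trinomial -(coef_map (intmul (1 : R))) /= rmorphXn /= !rmorphD /=.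
by rewrite map_polyXn map_polyZ map_polyX map_polyC.
Qed.

Section HalfDegreeCoefficient.

Variables (F : finFieldType) (h : nat).
Hypothesis cardF : #|F| = h.*2.+1.

(** The polynomial is the h-th power of a quartic, so its degree is 2(q - 1)
    and its coefficient of degree q - 1 is a character sum, up to the leading
    coefficient (-1) ^+ h. The latter cancels the term - qchar (-1) of
    [quartic_sum]. *)
Lemma coef_quartic_exp : 3 != 0 :> F ->
  (('X^2 - ('X^2 + 'X - 3%:P) ^+ 2 : {poly F}) ^+ h)`_(2 * h) =
  - (qchar (-2 : F) * cubic_sum (1 : F))%:~R.
Proof.
move=> three0; set P := _ - _.
have PE : P = Poly [:: -9; 6; 6; -2; -1].
  by rewrite /P /= !cons_poly_def -!polyCN; ring.
have Pseq : P = [:: -9; 6; 6; -2; -1] :> seq F.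
  by rewrite PE (PolyK (c := 1)) //= oppr_eq0 oner_eq0.
have sizeP : size (P ^+ h) = (h.*2.*2).+1.
  have P0 : P != 0 by rewrite -size_poly_gt0 Pseq.
  have := size_exp P h; have : (0 < size (P ^+ h))%N.
    by rewrite size_poly_gt0 expf_neq0.
  by rewrite (_ : size P = 5) ?Pseq //; set S := size _; lia.
have leadP : (P ^+ h)`_(h.*2.*2) = (-1) ^+ h.
  have -> : h.*2.*2 = (size (P ^+ h)).-1 by rewrite sizeP.
  by rewrite -/(lead_coef _) lead_coef_exp /lead_coef Pseq.
have /eqP := sum_horner cardF (eq_leq sizeP).
rewrite leadP opprD eq_sym subr_eq => /eqP/(congr1 -%R); rewrite opprK.
rewrite mul2n => ->; congr (- _).
transitivity ((\sum_(x : F) qchar ((3 - x ^+ 2) * (x ^+ 2 + 2 * x - 3)))%:~R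
  + (qchar (-1 : F))%:~R : F).
  rewrite (qcharE cardF) (rmorph_sum (intmul 1)); congr (_ + _).
  apply: eq_bigr => x _ /=; rewrite (qcharE cardF) horner_exp; congr (_ ^+ _).
  rewrite /P !hornerE; ring.
by rewrite (quartic_sum cardF three0) -intrD subrK.
Qed.

End HalfDegreeCoefficient.

(** * Computations in a prime field *)

Section PrimeField.

Variables (p h : nat).
Hypotheses (p_prime : prime p) (pE : p = h.*2.+1).

Lemma card_Fp_odd : #|'F_p| = h.*2.+1.
Proof. by rewrite card_Fp. Qed.

Lemma natFp_neq0 n : (0 < n < p)%N -> n%:R != 0 :> 'F_p.
Proof.
move=> /andP[n0 np]; rewrite -(dvdn_pcharf (pchar_Fp p_prime)).
by rewrite gtnNdvd.
Qed.

(** Modulo p, h = -1/2, and 'C(2 k, k) = (-4)^k times the binomial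
    coefficient of -1/2 over k. *)
Lemma bin_double_Fp k : (k <= h)%N ->
  'C(2 * k, k)%:R = (-4) ^+ k * 'C(h, k)%:R :> 'F_p.
Proof.
elim: k => [|k IH] lekh; first by rewrite !bin0 mulr1.
have k0 : k.+1%:R != 0 :> 'F_p by apply: natFp_neq0; lia.
apply: (mulfI k0); rewrite -natrM bin_double_rec natrM IH; last by lia.
rewrite [RHS]mulrCA -[k.+1%:R * _]natrM mul_bin_left !natrM natrB; last by lia.
have := natf_double card_Fp_odd; rewrite -mul2n natrM => h2.
rewrite -[(2 * k).+1]addn1 natrD natrM exprSr.
have -> : -4 = 2 * -2 :> 'F_p by ring.
transitivity ((2 * -2) ^+ k * (2 * (2 * k%:R - 2 * h%:R)) * 'C(h, k)%:R : 'F_p).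
  by rewrite h2; ring.
ring.
Qed.

(** The second supplement to quadratic reciprocity. Modulo p = 2 h + 1 the
    even numbers 2, 4, ..., 2 h are, up to order, the products (-1)^j j for
    1 <= j <= h: an even number that exceeds h is congruent to -j for the odd
    j = p - 2 k. Comparing the products gives 2^h h! = (-1)^(1 + ... + h) h!. *)
Lemma exp2_half : 2 ^+ h = (-1) ^+ 'C(h.+1, 2) :> 'F_p.
Proof.
have fact0 : \prod_(j < h) (j.+1%:R : 'F_p) != 0.
  by apply/prodf_neq0 => j _; apply: natFp_neq0; have := ltn_ord j; lia.
apply: (mulIf fact0).
have sgn n : \prod_(j < n) (-1) ^+ j.+1 = (-1) ^+ 'C(n.+1, 2) :> 'F_p.
  elim: n => [|n IH]; first by rewrite big_ord0.
  by rewrite big_ord_recr /= IH -exprD [in RHS]binS bin1.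
rewrite -sgn -big_split /=.
have -> : 2 ^+ h = \prod_(j < h) (2 : 'F_p) by rewrite prodr_const card_ord.
rewrite -big_split /=.
(* the index of 2 k.+1, with all indices lowered by 1 *)
pose s k := (if 2 * k.+1 <= h then (2 * k).+1 else 2 * (h - k.+1))%N.
have s_lt (k : 'I_h) : (s k < h)%N.
  by have := ltn_ord k; rewrite /s; case: ifP; lia.
rewrite [RHS](reindex_inj (h := fun k => Ordinal (s_lt k))) /=; last first.
  move=> k l /(congr1 val) /=; rewrite /s => e; apply: val_inj => /=.
  have := ltn_ord k; have := ltn_ord l; move: e.
  by case: ifP; case: ifP; lia.
apply: eq_bigr => k _; rewrite /s; case: ifP => _.
  by rewrite -signr_odd /= oddM /= expr0 mul1r -natrM mulnS.
rewrite -signr_odd /= oddM /= expr1.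
have := natf_double card_Fp_odd; rewrite -mul2n natrM => h2.
by rewrite -[in RHS]natr1 natrM natrB ?ltn_ord // mulrBr h2; ring.
Qed.

Lemma qchar_N2 : qchar (-2 : 'F_p) = (-1) ^+ ('C(h.+1, 2) + h).
Proof.
apply: (sign_intr_inj card_Fp_odd); rewrite ?qchar_le1 //.
  by rewrite normrX normrN1 expr1n.
rewrite (qcharE card_Fp_odd) rmorphXn /= mulrN1z -mulN1r exprMn exp2_half.
by rewrite exprD mulrC.
Qed.

(** By [bin_double_Fp] the weights become (-1)^k 'C(h, k), and the sum becomes
    the coefficient of [coef_exp_diff_sqr] with Q = 'X^2 + 'X - 3. *)
Lemma binomial_trinomial_sum : (3 < p)%N ->
  \sum_(k < h.+1) 'C(2 * k, k)%:R * (trinomial (2 * k) 1 (-3))%:~R / 4 ^+ k =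
  - (qchar (-2 : 'F_p) * cubic_sum (1 : 'F_p))%:~R :> 'F_p.
Proof.
move=> p3; rewrite -(coef_quartic_exp card_Fp_odd) ?natFp_neq0 //.
rewrite coef_exp_diff_sqr; apply: eq_bigr => k _.
have four0 : 4 != 0 :> 'F_p by apply: natFp_neq0; lia.
rewrite bin_double_Fp -1?ltnS // intr_trinomial scale1r.
rewrite (_ : ((-3)%:~R)%:P = - 3%:P :> {poly 'F_p}); last first.
  by rewrite -polyCN.
rewrite -[-4]mulN1r exprMn; set T := _`_ _.
by field; rewrite expf_neq0.
Qed.

End PrimeField.

(** * Representations by x^2 + 3 y^2, and the congruence *)

(** p divides (x E - y C) (- x E - y C) = p (y^2 - E^2), so up to the sign of E
    it divides x E - y C. As p^2 = (x C + 3 y E)^2 + 3 (x E - y C)^2, that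
    number vanishes, and then so does p (E^2 - y^2). *)
Lemma repr_unique p (x y C E : int) : prime p ->
  x ^+ 2 + 3 * y ^+ 2 = p%:Z -> C ^+ 2 + 3 * E ^+ 2 = p%:Z ->
  x = C \/ x = - C.
Proof.
move=> p_prime xy CE.
suff main (e : int) : (p%:Z %| x * e - y * C)%Z -> C ^+ 2 + 3 * e ^+ 2 = p%:Z ->
    x ^+ 2 = C ^+ 2.
  suff : x ^+ 2 = C ^+ 2 by move=> /eqP; rewrite eqf_sqr => /orP[]/eqP; auto.
  have : (p%:Z %| (x * E - y * C) * (x * (- E) - y * C))%Z.
    apply/dvdzP; exists (y ^+ 2 - E ^+ 2).
    transitivity (y ^+ 2 * C ^+ 2 - x ^+ 2 * E ^+ 2); first by ring.
    have -> : C ^+ 2 = p%:Z - 3 * E ^+ 2 by lia.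
    have -> : x ^+ 2 = p%:Z - 3 * y ^+ 2 by lia.
    ring.
  rewrite dvdzE abszM Euclid_dvdM // -!dvdzE.
  by move=> /orP[] d; [apply: (main E)|apply: (main (- E)); rewrite ?sqrrN].
move=> /dvdzP[t tE] Ce.
have t0 : t = 0.
  have p0 : p%:Z > 0 by have := prime_gt0 p_prime; lia.
  have : p%:Z ^+ 2 = (x * C + 3 * y * e) ^+ 2 + 3 * (t * p%:Z) ^+ 2.
    rewrite -tE expr2 -{1}xy -Ce; ring.
  move=> eq; apply/eqP/negPn/negP => tn0.
  have t1 : 0 <= t ^+ 2 - 1.
    by rewrite subr_ge0 -gtz0_ge1 exprn_even_gt0.
  have := mulr_ge0 (sqr_ge0 p%:Z) t1; have := sqr_ge0 (x * C + 3 * y * e).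
  have : 0 < p%:Z ^+ 2 by rewrite exprn_gt0.
  move: eq; rewrite exprMn; set a := (_ + _) ^+ 2.
  move: a (p%:Z ^+ 2) (t ^+ 2) => a P T; clear; lia.
move: tE; rewrite t0 mul0r => tE.
have p0 : p%:Z != 0 by have := prime_gt0 p_prime; lia.
have : p%:Z * (e ^+ 2 - y ^+ 2) = 0.
  rewrite mulrBr -{1}xy -Ce.
  transitivity ((x * e - y * C) * (x * e + y * C)); first by ring.
  by rewrite tE mul0r.
by move=> /eqP; rewrite mulf_eq0 (negPf p0) /= subr_eq0 => /eqP; lia.
Qed.

(** A common denominator D prime to p reduces the congruence of a rational
    number with an integer to a divisibility between integers. *)
Lemma ratcong_int p (a : rat) (D N c : int) : D != 0 -> coprimez D p%:Z ->
  a * D%:~R = N%:~R -> (p%:Z %| N - c * D)%Z -> ratcong p a c%:~R.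
Proof.
move=> D0 coD aD pdvd.
have numM (b : rat) (M : int) : b * D%:~R = M%:~R -> numq b * D = M * denq b.
  move=> bD; apply/eqP; rewrite -(eqr_int rat) !intrM -bD.
  by rewrite numqE mulrAC.
split.
- have dD : (denq a %| D)%Z.
    rewrite -(Gauss_dvdzr (n := numq a)) ?(numM _ _ aD) ?dvdz_mull //.
    by rewrite coprimezE coprime_sym coprime_num_den.
  by move: dD coD; rewrite dvdzE !coprimezE; exact: coprime_dvdl.
- by rewrite denq_int coprimezE coprime1n.
- have e : (a - c%:~R) * D%:~R = (N - c * D)%:~R.
    by rewrite mulrBl aD intrB intrM.
  rewrite -(Gauss_dvdzl _ (p := D)) 1?coprimez_sym //.
  by rewrite (numM _ _ e) dvdz_mulr.
Qed.

Lemma legendre3 (j : int) :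
  legendre (3 * j + 1) 3 = 1 /\ legendre (3 * j - 1) 3 = -1.
Proof.
have mod3 (i : 'I_3) (a : int) : (i%:Z ^+ 2 == a %[mod 3])%Z ->
    a = 0 %[mod 3]%Z \/ a = 1 %[mod 3]%Z.
  by move=> /eqP <-; case: i => [[|[|[|]]]] //= _; [left|right|right].
have nd (r : int) : (r %% 3)%Z != 0 -> (3%:Z %| 3 * j + r)%Z = false.
  move=> r0; apply/negP => /dvdzP[q qE]; move: r0.
  by rewrite (_ : r = (q - j) * 3) ?modzMl //; lia.
split; rewrite /legendre nd //.
  case: existsP => // -[]; exists (Ordinal (isT : (1 < 3)%N)).
  by rewrite /= [3 * j]mulrC modzMDl.
case: existsP => // -[i /mod3]; rewrite [3 * j]mulrC modzMDl.
by case.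
Qed.

(** The left side depends on x y / 2 modulo 2, the right side on 2 h + 1
    modulo 8. As x and y have opposite parities, each of the two cases is
    settled by halving the even one and by the fact that a square has the
    parity of its root. *)
Lemma sign_exponent (h : nat) (x y : int) :
  (h.*2.+1)%:Z = x ^+ 2 + 3 * y ^+ 2 ->
  ((-1) ^ (x * y %/ 2)%Z : rat) = ((-1) ^+ ('C(h.+1, 2) + h))%:~R.
Proof.
move=> hE; set n := ('C(_, _) + h)%N; set s := (_ %/ 2)%Z.
have nE : 2 * n%:Z = h%:Z * (h%:Z + 3).
  have := bin2 h.+1; have := odd_double_half (h.+1 * h); rewrite oddM /= andNb.
  by rewrite /n /= => ? ?; nia.
suff [e neE] : exists e, n%:Z = s + 2 * e.
  rewrite expN1r -signr_odd -[(-1) ^+ n]signr_odd rmorphXn /= mulrN1z.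
  by congr (_ ^+ _); congr nat_of_bool; lia.
have parity (t : int) : exists a, t = 2 * a \/ t = 2 * a + 1.
  by exists (t %/ 2)%Z; lia.
have sqr_sub (a : int) : exists A, a ^+ 2 = 2 * A + a.
  have [u [-> | ->]] := parity a.
    by exists (2 * u ^+ 2 - u); ring.
  by exists (2 * u ^+ 2 + u); ring.
have halve (t : int) : (2 * t %/ 2)%Z = t by rewrite mulKz.
have [a [xE | xE]] := parity x; have [b [yE | yE]] := parity y.
- by exfalso; move: hE; rewrite xE yE; lia.
- have [A AE] := sqr_sub a; have [U UE] := sqr_sub b; pose T := U + b.
  have sE : s = a * (2 * b + 1) by rewrite /s xE yE -mulrA halve.
  have hE' : h%:Z = 2 * a ^+ 2 + 12 * T + 1.
    by move: hE; rewrite xE yE /T; lia.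
  have nE' : n%:Z = (2 * a ^+ 2 + 12 * T + 1) * (a ^+ 2 + 6 * T + 2).
    by move: nE; rewrite hE'; clear; lia.
  exists ((a ^+ 2 + 6 * T) * (a ^+ 2 + 6 * T + 2) + 3 * T + 1 + A - a * b).
  by rewrite nE' sE; lia.
- have [A AE] := sqr_sub b; have [U UE] := sqr_sub a; pose T := U + a.
  have sE : s = b * (2 * a + 1) by rewrite /s xE yE mulrCA halve mulrC.
  have hE' : h%:Z = 4 * T + 6 * b ^+ 2.
    by move: hE; rewrite xE yE /T; lia.
  have nE' : n%:Z = (2 * T + 3 * b ^+ 2) * (4 * T + 6 * b ^+ 2 + 3).
    by move: nE; rewrite hE'; clear; lia.
  exists (T * (4 * T + 6 * b ^+ 2 + 3) + 3 * b ^+ 2 * (2 * T + 3 * b ^+ 2)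
          + 4 * b ^+ 2 + A - a * b).
  by rewrite nE' sE; lia.
- by exfalso; move: hE; rewrite xE yE; lia.
Qed.

Theorem corollary5p12 (p : nat) (p_prime : prime p) (p_gt3 : (3 < p)%N) :
  let Sp : rat :=
    \sum_(0 <= k < ((p - 1) %/ 2).+1)
      'C(2 * k, k)%:R * (trinomial (2 * k) 1 (-3))%:~R / 4%:R ^+ k in
  (forall x y : int, p%:Z = x ^+ 2 + 3 * y ^+ 2 ->
     ratcong p Sp
       ((-1) ^ (x * y %/ 2)%Z * (legendre x 3)%:~R * (2 * x)%:~R))
  /\ (p = 2 %[mod 3] -> ratcong p Sp 0).
Proof.
move=> Sp.
have p_odd : odd p by case: (even_prime p_prime) => // p2; rewrite p2 in p_gt3.
pose h := p./2; have pE : p = h.*2.+1 by rewrite -[LHS]odd_double_half p_odd.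
(* 4 ^+ h is a common denominator of the sum *)
pose tr k : int := 'C(2 * k, k)%:Z * trinomial (2 * k) 1 (-3).
pose N : int := \sum_(k < h.+1) tr k * 4 ^+ (h - k).
have SpE : Sp * (4 ^+ h)%:~R = N%:~R.
  rewrite /Sp big_mkord (_ : ((p - 1) %/ 2 = h)%N); last by lia.
  rewrite mulr_suml (rmorph_sum (intmul 1)); apply: eq_bigr => k _ /=.
  rewrite !intrM !rmorphXn /=.
  have -> : 4%:~R ^+ h = 4%:~R ^+ (h - k) * 4%:~R ^+ k :> rat.
    by rewrite -exprD subnK ?leq_ord.
  by field; rewrite expf_neq0.
have cardF := card_Fp_odd p_prime pE.
have NE : N%:~R =
    - (qchar (-2 : 'F_p) * cubic_sum (1 : 'F_p) * 4 ^+ h)%:~R :> 'F_p.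
  rewrite intrM -mulNr -(binomial_trinomial_sum p_prime pE) //.
  rewrite (rmorph_sum (intmul 1)) mulr_suml; apply: eq_bigr => k _ /=.
  have four0 : 4 != 0 :> 'F_p by apply: (natFp_neq0 p_prime); lia.
  rewrite !intrM !rmorphXn /=.
  have -> : 4%:~R ^+ h = 4%:~R ^+ (h - k) * 4%:~R ^+ k :> 'F_p.
    by rewrite -exprD subnK ?leq_ord.
  by field; rewrite expf_neq0.
have reduce (c : int) : c = - (qchar (-2 : 'F_p) * cubic_sum (1 : 'F_p)) ->
    ratcong p Sp c%:~R.
  move=> cE; apply: ratcong_int SpE _.
  - by rewrite expf_neq0.
  - by rewrite coprimezE abszX coprimeXl // (@coprimeXl 2 2) // coprime2n.
  - rewrite (dvdz_pcharf (pchar_Fp p_prime)) intrB NE cE mulNr mulrNz.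
    by rewrite subrr.
split=> [x y pxy | p2]; last first.
  apply: (reduce 0).
  rewrite (@cubic_sum_eq0 _ _ cardF (p %/ 3)) ?mulr0 ?oppr0 //.
  by rewrite card_Fp //; lia.
have [j xE] : exists j, x = 3 * j + 1 \/ x = 3 * j - 1.
  have [j [xE | xE]] : exists j, x = 3 * j \/ (x = 3 * j + 1 \/ x = 3 * j - 1).
  - by exists ((x + 1) %/ 3)%Z; lia.
  - have : (3 %| p)%N by apply/dvdnP; exists `|(3 * j ^+ 2 + y ^+ 2)%R|%N; lia.
    by rewrite dvdn_prime2 // => /eqP p3; rewrite -p3 in p_gt3.
  - by exists j.
have p1 : (p %% 3 = 1)%N.
  by case: xE => xE; move: pxy; rewrite xE; lia.
pose m := (h %/ 3)%N.
have cardF3 : #|'F_p| = (3 * m).*2.+1 by rewrite cardF /m; lia.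
have [z zP] := prim_root_exists cardF3.
have [C [E [AE CE [k kE]]]] := cubic_sum1_norm cardF3 zP.
rewrite (sign_exponent (h := h)) -?pE // -!intrM.
apply: reduce; rewrite (qchar_N2 p_prime pE) -!mulrA -mulrN; congr (_ * _).
rewrite AE; have [l1 l2] := legendre3 j.
(* both x and C are known modulo 3, which decides the sign *)
have [xC|xC] : x = C \/ x = - C.
  by apply: (repr_unique p_prime (y := y) (E := E)); rewrite // CE card_Fp.
- have xE' : x = 3 * j - 1 by move: xE xC kE; clear; lia.
  by rewrite {1}xE' l2 mulN1r xC.
- have xE' : x = 3 * j + 1 by move: xE xC kE; clear; lia.
  by rewrite {1}xE' l1 mul1r xC mulrN.
Qed.
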